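(* Fix $\alpha\in(0,1)$, $\tau>0$, integers $n,N\ge 1$, and a loss $\ell:\widehat{\mathcal Y}\times\mathcal Y\to\mathbb R_+$. Assume that either $|\mathcal X|=\infty$ or $|\mathcal Y|=\infty$, and that $\ell$ takes values in $[0,B]$. Let $\widehat T$ be a black-box test for algorithm evaluation, and assume that $\widehat T$ satisfies the assumption-free validity condition $$\mathbb P_P\big(\widehat T(\mathcal A,\mathcal D_N)=1\big)\le\alpha\quad\text{for any algorithm }\mathcal A\text{ and any distribution }P\text{ on }\mathcal X\times\mathcal Y\text{ such that }R_{P,n}(\mathcal A)\ge\tau .$$ Let $\tilde\tau=\tau\left(1+\frac{\alpha^{-1}-1}{N}\right)$. Then for any algorithm $\mathcal A$ and any distribution $P$ on $\mathcal X\times\mathcal Y$ with $R_{P,n}(\mathcal A)<\tau$ and $\tilde\tau<R_P^{\max}$, $$\mathbb P_P\big(\widehat T(\mathcal A,\mathcal D_N)=1\big)\le\left[\alpha\left(1+\frac{\tilde\tau-R_{P,n}(\mathcal A)}{R_P^{\max}-\tilde\tau}\right)^{N/n}\right]\wedge 1 .$$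
   Context: $\mathcal X,\mathcal Y,\widehat{\mathcal Y}$ are measurable spaces; all functions are assumed measurable as appropriate, and singletons $\{(x,y)\}\subset\mathcal X\times\mathcal Y$ are measurable. $a\wedge b=\min(a,b)$; $[n]=\{1,\dots,n\}$. Algorithm: a map $\mathcal A:\bigcup_{m\ge0}(\mathcal X\times\mathcal Y)^m\times[0,1]\to\{\text{measurable functions }\mathcal X\to\widehat{\mathcal Y}\}$, taking a data set (a finite tuple of any size) and a random seed $\xi\in[0,1]$ and returning a fitted model $\mathcal A(\mathcal D;\xi)$; for each $m$ the map $((x_1,y_1),\dots,(x_m,y_m),\xi,x)\mapsto[\mathcal A(\{(x_i,y_i)\}_{i\in[m]};\xi)](x)$ is measurable. No symmetry in the data points is assumed. Risk: for measurable $f:\mathcal X\to\widehat{\mathcal Y}$, $R_P(f)=\mathbb E_P[\ell(f(X),Y)]$ with $(X,Y)\sim P$, and $R_P^{\max}=\sup_f R_P(f)$ over all such $f$. For an algorithm, $R_{P,n}(\mathcal A)=\mathbb E[\ell(\hat f_n(X_{n+1}),Y_{n+1})]$ where $\hat f_n=\mathcal A(\{(X_i,Y_i)\}_{i\in[n]};\xi)$, $(X_1,Y_1),\dots,(X_{n+1},Y_{n+1})$ are i.i.d. from $P$, and $\xi\sim\mathrm{Unif}[0,1]$ is independent of them. Data: $\mathcal D_N=\{(X_i,Y_i)\}_{i\in[N]}$ with $(X_i,Y_i)$ i.i.d. from $P$. $\mathbb P_P$ is over $\mathcal D_N$ and any randomization in $\widehat T$. Black-box test (algorithm evaluation): let $\mathfrak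 D=\bigcup_{m\ge0}(\mathcal X\times\mathcal Y)^m$. A function $\widehat T$ taking an algorithm $\mathcal A$ and a data set $\mathcal D\in\mathfrak D$ and returning a (possibly randomized) output $\widehat T(\mathcal A,\mathcal D)\in\{0,1\}$ is a black-box test if, for some functions $g^{(1)},g^{(2)},\dots,g$ (not depending on $\mathcal A$) and random seeds $\zeta^{(1)},\zeta^{(2)},\dots,\zeta$ i.i.d. $\mathrm{Unif}[0,1]$ (independent of the data), it is produced as follows. (1) At stage $r=1$, generate a data set in $\mathfrak D$ and a seed in $[0,1]$, $(\mathcal D^{(1)},\xi^{(1)})=g^{(1)}(\mathcal D,\zeta^{(1)})$, and compute $\hat f^{(1)}=\mathcal A(\mathcal D^{(1)};\xi^{(1)})$. (2) For each stage $r=2,3,\dots$, generate $(\mathcal D^{(r)},\xi^{(r)})=g^{(r)}\big(\mathcal D,(\mathcal D^{(s)})_{1\le s<r},(\hat f^{(s)})_{1\le s<r},(\zeta^{(s)})_{1\le s\le r},(\xi^{(s)})_{1\le s<r}\big)$ and compute $\hat f^{(r)}=\mathcal A(\mathcal D^{(r)};\xi^{(r)})$. (3) Repeat until some stopping criterion (evaluated on the information generated so far) is reached; $\hat r$ denotes the data-dependent total number of rounds, which is finite. (4) Return $\widehat T(\mathcal A,\mathcal D)=g\big(\mathcal D,(\mathcal D^{(r)})_{1\le r\le\hat r},(\hat f^{(r)})_{1\le r\le\hat r},(\zeta^{(r)})_{1\le r\le\hat r},(\xi^{(r)})_{1\le r\le\hat r},\zeta\big)$. The map $(\mathcal D,\zeta^{(1)},\zeta^{(2)},\dots,\zeta)\mapsto\widehat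 T(\mathcal A,\mathcal D)$ is assumed measurable. *)

(* Defs.v *)
From HB Require Import structures.
From mathcomp Require Import all_boot all_order all_algebra.
From mathcomp Require Import all_classical all_reals all_analysis.
From mathcomp Require Import measurable_realfun.

Set Implicit Arguments.
Unset Strict Implicit.
Unset Printing Implicit Defensive.
Import Order.TTheory GRing.Theory Num.Theory.
Import numFieldNormedType.Exports.

Local Open Scope classical_set_scope.
Local Open Scope ring_scope.

(* [unit_pt R] is the type {i01 R} of points of [0, 1], renamed so as to carry
   the trace of the Borel sigma-algebra of R. *)
Definition unit_pt (R : realType) : Type := {i01 R}.

Definition unit_val (R : realType) (u : unit_pt R) : R := (u : {i01 R})%:num.

Section unit_measurable.
Variable R : realType.

HB.instance Definition _ := gen_eqMixin (unit_pt R).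
HB.instance Definition _ := gen_choiceMixin (unit_pt R).
HB.instance Definition _ :=
  isPointed.Build (unit_pt R) (Itv01 (lexx 0) ler01 : {i01 R}).

HB.instance Definition _ := Measurable.copy (unit_pt R)
  (g_sigma_algebra_preimageType (@unit_val R)).

Lemma measurable_unit_val : measurable_fun setT (@unit_val R).
Proof. by move=> _ A mA; exists A. Qed.

Lemma clamp_ge0 (x : R) : 0 <= Num.max 0 (Num.min x 1).
Proof. by rewrite le_max lexx. Qed.

Lemma clamp_le1 (x : R) : Num.max 0 (Num.min x 1) <= 1.
Proof. by rewrite ge_max ler01 ge_min lexx orbT. Qed.

Definition clamp (x : measurableTypeR R) : unit_pt R :=
  Itv01 (clamp_ge0 x) (clamp_le1 x).

Lemma measurable_clamp : measurable_fun setT clamp.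
Proof.
move=> _ _ [B mB <-]; rewrite !setTI -comp_preimage.
rewrite -[X in measurable X]setTI.
suff : measurable_fun setT (@unit_val R \o clamp) by apply.
by apply: measurable_maxr => //; exact: measurable_minr.
Qed.

HB.instance Definition _ :=
  isMeasurableFun.Build _ _ _ _ clamp measurable_clamp.

(* The uniform law on R charges only [0, 1], where [clamp] is the identity. *)
Definition unif01 : probability (unit_pt R) R :=
  distribution (uniform_prob (@ltr01 R)) clamp.

Lemma unif01_val (B : set R) : measurable B ->
  unif01 (@unit_val R @^-1` B) = lebesgue_measure (B `&` `[0, 1]).
Proof.
move=> mB.
transitivity (\int[lebesgue_measure]_(x in (@unit_val R \o clamp) @^-1` B)
    (uniform_pdf 0 1 x)%:E)%E; first by [].
rewrite integral_uniform_pdf.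
have -> : (@unit_val R \o clamp) @^-1` B `&` `[0, 1] = B `&` `[0, 1].
  apply/seteqP; split=> x /= [Bx x01]; split=> //.
    move: Bx x01; rewrite in_itv/= => + /andP[x0 x1].
    by rewrite /unit_val/= (min_idPl x1) (max_idPr x0).
  move: Bx x01; rewrite in_itv/= => + /andP[x0 x1].
  by rewrite /unit_val/= (min_idPl x1) (max_idPr x0).
rewrite (eq_integral (cst 1%E)); last first.
  move=> x; rewrite inE/= => -[_]; rewrite /uniform_pdf in_itv/= => ->.
  by rewrite subr0 invr1.
by rewrite integral_cst ?mul1e//; exact: measurableI.
Qed.

End unit_measurable.

Section iid_law.
Context (R : realType) (d : measure_display) (Z : measurableType d).

Definition cons_pair n (w : Z * n.-tuple Z) : n.+1.-tuple Z :=
  [tuple of w.1 :: w.2].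

Lemma measurable_cons_pair n : measurable_fun setT (@cons_pair n).
Proof. exact: measurable_cons. Qed.

HB.instance Definition _ n :=
  isMeasurableFun.Build _ _ _ _ (@cons_pair n) (@measurable_cons_pair n).

Fixpoint iid (P : probability Z R) (n : nat) : probability (n.-tuple Z) R :=
  match n with
  | 0 => \d_ [tuple]
  | m.+1 => distribution (P \x iid P m)%E (@cons_pair m)
  end.

Lemma iid_box (P : probability Z R) n (A : 'I_n -> set Z) :
  (forall i, measurable (A i)) ->
  iid P n [set t | forall i, A i (tnth t i)] = (\prod_(i < n) P (A i))%E.
Proof.
elim: n A => [|n IH] A mA.
  by rewrite big_ord0 /= diracE mem_set// => -[].
rewrite big_ord_recl -IH// -product_measure1E//=; last first.
  rewrite (_ : mkset _ = \bigcap_(i in [set: 'I_n])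
      ((fun t => tnth t i) @^-1` A (lift ord0 i))); last first.
    by apply/seteqP; split=> t /= H i => [_|]; exact: H.
  apply: fin_bigcap_measurable => // i _; rewrite -[X in measurable X]setTI.
  exact: measurable_tnth.
rewrite /distribution /pushforward; congr ((_ \x _)%E _).
apply/seteqP; split=> -[z t] /= => [H|[A0 At] i].
  split=> [|i]; first by have := H ord0; rewrite tnth0.
  by have := H (lift ord0 i); rewrite tnthS.
by case: (unliftP ord0 i) => [j ->|->]; rewrite ?tnthS ?tnth0.
Qed.

End iid_law.

(* Seed sequences, with the product sigma-algebra of [0, 1]^nat. *)
Definition seeds (R : realType) : Type :=
  g_sigma_algebraType (\bigcup_(i in [set: nat]) preimage_set_system
    [set: nat -> unit_pt R] (fun z => z i) measurable).

(* The coordinates are i.i.d. Unif[0, 1]; this determines [Q]. *)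
Definition iid_unif01 (R : realType) (Q : probability (seeds R) R) : Prop :=
  forall (k : nat) (A : nat -> set (unit_pt R)),
    (forall i, measurable (A i)) ->
    Q [set z | forall i, (i < k)%N -> A i (z i)] =
      (\prod_(i < k) unif01 R (A i))%E.

Section algorithm_evaluation.
Context (R : realType) (dX dY dV : measure_display).
Context (X : measurableType dX) (Y : measurableType dY) (V : measurableType dV).

(* [V] is the space of predictions. A data set is an element of [seq (X * Y)],
   the union over m of (X * Y)^m. *)
Record algorithm := Algorithm {
  fit :> seq (X * Y) -> unit_pt R -> {mfun X >-> V};
  fit_measurable : forall m : nat, measurable_fun setT
    (fun w : m.-tuple (X * Y) * unit_pt R * X => fit w.1.1 w.1.2 w.2)
}.

Section risk.
Variable ell : V * Y -> R.

Definition risk (P : probability (X * Y)%type R) (f : {mfun X >-> V}) : \bar R :=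
  'E_P[fun z => ell (f z.1, z.2)].

Definition max_risk (P : probability (X * Y)%type R) : \bar R :=
  ereal_sup (range (risk P)).

(* [w] is (training data, seed, test point). *)
Definition algorithm_risk (P : probability (X * Y)%type R) (n : nat)
    (A : algorithm) : \bar R :=
  'E_(iid P n \x unif01 R \x P)%E[fun w => ell (A w.1.1 w.1.2 w.2.1, w.2.2)].

End risk.

Record round := Round {
  round_data : seq (X * Y);
  round_model : {mfun X >-> V};
  round_zeta : unit_pt R;
  round_xi : unit_pt R
}.

(* [query r] is the function g^(r), r >= 1, applied to the input data set, the
   rounds 1, .., r - 1 in this order, and the new seed zeta^(r); [answer] is the
   final function g. These maps need not be measurable: only the final output
   is required to be, in [black_box_test]. *)
Record protocol := Protocol {
  query : nat -> seq (X * Y) -> seq round -> unit_pt R ->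
    seq (X * Y) * unit_pt R;
  stop : seq (X * Y) -> seq round -> bool;
  answer : seq (X * Y) -> seq round -> unit_pt R -> bool
}.

(* The first [r] rounds, ignoring the stopping criterion. Coordinate s >= 1 of
   [zeta] is zeta^(s); coordinate 0 is the seed used by [answer]. *)
Fixpoint rounds (p : protocol) (A : algorithm) (D : seq (X * Y))
    (zeta : seeds R) (r : nat) : seq round :=
  if r is s.+1 then
    let h := rounds p A D zeta s in
    let q := query p r D h (zeta r) in
    rcons h (Round q.1 (A q.1 q.2) (zeta r) q.2)
  else [::].

(* The last argument collects all the random seeds of the test. *)
Definition randomized_test := algorithm -> seq (X * Y) -> seeds R -> bool.

Definition runs_protocol (p : protocol) (T : randomized_test) : Prop :=
  forall (A : algorithm) (D : seq (X * Y)) (zeta : seeds R),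
    exists rhat : nat,
      [/\ (0 < rhat)%N,
          stop p D (rounds p A D zeta rhat),
          forall r, (0 < r < rhat)%N -> ~~ stop p D (rounds p A D zeta r)
        & T A D zeta = answer p D (rounds p A D zeta rhat) (zeta 0%N)].

Definition black_box_test (T : randomized_test) : Prop :=
  (exists p : protocol, runs_protocol p T) /\
  (forall (A : algorithm) (m : nat), measurable_fun setT
    (fun w : m.-tuple (X * Y) * seeds R => T A w.1 w.2)).

Definition reject_prob (Q : probability (seeds R) R) (T : randomized_test)
    (A : algorithm) (P : probability (X * Y)%type R) (N : nat) : \bar R :=
  (iid P N \x Q)%E
    [set w : N.-tuple (X * Y) * seeds R | T A w.1 w.2 = true].

End algorithm_evaluation.

Arguments max_risk {R dX dY dV X Y V} ell P.

(* Main.v *)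
Require Import Defs.
From HB Require Import structures.
From mathcomp Require Import all_boot all_order all_algebra.
From mathcomp Require Import all_classical all_reals all_analysis.
From mathcomp Require Import measurable_realfun.
From mathcomp Require Import lra ring.

Set Implicit Arguments.
Unset Strict Implicit.
Unset Printing Implicit Defensive.
Import Order.TTheory GRing.Theory Num.Theory.
Import numFieldNormedType.Exports.

(** A test that only sees an algorithm through finitely many fitted models cannot
    detect a change of behaviour on data sets it never submits. Fix [q] in [0, 1]
    and a model [f] of nearly maximal risk, and let [z k] be a sequence of
    distinct points. The algorithm [backdoor A (z k) f] fits [f] as soon as [z k]
    occurs in the training data and behaves as [A] otherwise, and
    [contaminate P (z k)] is the mixture giving mass [1 - q] to [z k] and weight
    [q] to [P].

    Under the mixture the [n] training points contain [z k] with probability at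
    least [1 - q ^+ n], so the modified algorithm has risk at least about
    [q * (q ^+ n * Rn + (1 - q ^+ n) * Rmax)] ([algorithm_risk_backdoor_ge]). When
    this exceeds [tau], validity bounds by [alpha] the probability that the
    test returns 1 on it. But the [N] data points all come from [P] with
    probability at least [q ^+ N]; and each outcome of the data and of the seeds
    makes the test submit finitely many points to [A], which for large [k] do not
    include [z k]: the test then returns the same answer for the modified algorithm
    as for [A] ([near_backdoor_test], [near_reject_backdoor]). Hence
    [q ^+ N] times the rejection probability of [A] is at most [alpha]
    ([mixture_reject_le_max]).

    It remains to choose [q] ([reject_bound_of_levels]). The level where
    [q ^+ n = (Rmax - tau') / (Rmax - Rn)] gives the stated bound, provided that
    [tau / tau' < q]; for a smaller [q], Bernoulli's inequality shows that the stated
    bound is at least 1. *)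

Local Open Scope classical_set_scope.
Local Open Scope ring_scope.

(** * Events that every outcome eventually leaves *)

Section avoided.
Context d (T : measurableType d) (R : realType).

(** The tail unions of [E] decrease to the limit superior of [E], which is empty
    because no point lies in infinitely many of the sets; continuity from above
    then sends their finite measures to 0. *)
Lemma near_measure_lt (mu : {finite_measure set T -> \bar R})
    (E : (set T)^nat) (e : R) :
  0 < e -> (forall k, measurable (E k)) ->
  (forall x, \forall k \near \oo, ~ E k x) ->
  \forall k \near \oo, (mu (E k) < e%:E)%E.
Proof.
move=> e0 mE avoid.
have mU k : d.-measurable (\bigcup_(j >= k) E j) by exact: bigcup_measurable.
have fin : (mu (\bigcup_(k >= 0) E k) < +oo)%E.
  by rewrite -ge0_fin_numE// fin_num_measure.
have limE : lim_sup_set E = set0.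
  apply/seteqP; split=> // x lx; have [k0 _ Ek0] := avoid x.
  by have [j /= k0j Ej] := lx k0 Logic.I; exact: Ek0 Ej.
have := lim_sup_set_cvg mu E mE fin; rewrite limE measure0 => cvg0.
have : \forall k \near \oo, (mu (\bigcup_(j >= k) E j) < e%:E)%E.
  move/fine_cvgP : cvg0 => [_ /cvgrPdist_lt/(_ e e0)] [k0 _ Hk0].
  exists k0 => // k k0k; have := Hk0 k k0k.
  rewrite sub0r normrN ger0_norm ?fine_ge0//.
  by rewrite -lte_fin fineK// fin_num_measure.
move=> [k0 _ Hk0]; exists k0 => // k k0k; apply: le_lt_trans (Hk0 k k0k).
rewrite le_measure ?inE// => x Ex; exists k => //=.
Qed.

End avoided.

(** The terms of a finite list are hit by finitely many indices only: this is
    where an infinite sample space is used. *)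
Lemma near_notin (T : eqType) (u : nat -> T) (s : seq T) :
  injective u -> \forall k \near \oo, u k \notin s.
Proof.
move=> inju; elim: s => [|x s IH]; first exact: nearW.
have neqx : \forall k \near \oo, u k != x.
  have [[k0 <-]|nx] := pselect (exists k0, u k0 = x); last first.
    by apply: nearW => k; apply/eqP => ukx; apply: nx; exists k.
  by exists k0.+1 => // k /= k0k; rewrite (inj_eq inju) gtn_eqF.
by apply: filterS2 neqx IH => k ukx uks; rewrite inE negb_or ukx.
Qed.

Lemma infinite_prod (S U : pointedType) :
  infinite_set [set: S] \/ infinite_set [set: U] -> infinite_set [set: S * U].
Proof.
move=> inf fin; case: inf; apply.
- have := finite_image (@fst S U) fin; apply: sub_finite_set => s _.
  by exists (s, point).
- have := finite_image (@snd S U) fin; apply: sub_finite_set => u _.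
  by exists (point, u).
Qed.

(** * Domination between product measures *)

Section domination.
Local Open Scope ereal_scope.
Context (R : realType).

(** Product laws of a mixture are awkward to expand. All lower bounds below use
    only that the mixture dominates a multiple of one of its components, a
    property stable under products. *)
Definition scaled_le d (T : measurableType d) (c : R) (mu nu : set T -> \bar R) :=
  forall S, measurable S -> c%:E * mu S <= nu S.

Lemma scaled_le_integral d (T : measurableType d) (c : R)
    (mu nu : {measure set T -> \bar R}) (S : set T) (f : T -> \bar R) :
  (0 <= c)%R -> scaled_le c mu nu -> measurable S -> measurable_fun setT f ->
  (forall x, 0 <= f x) ->
  c%:E * \int[mu]_(x in S) f x <= \int[nu]_(x in S) f x.
Proof.
move=> c0 le mS mf f0; rewrite -[c]/((NngNum c0)%:num)%R.
rewrite -ge0_integral_mscale//; last exact: measurable_funTS.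
exact: ge0_le_measure_integral.
Qed.

Lemma scaled_le_prod d1 d2 (T1 : measurableType d1) (T2 : measurableType d2)
    (c1 c2 : R) (mu1 nu1 : probability T1 R) (mu2 nu2 : probability T2 R) :
  (0 <= c1)%R -> (0 <= c2)%R -> scaled_le c1 mu1 nu1 -> scaled_le c2 mu2 nu2 ->
  scaled_le (c1 * c2) (mu1 \x mu2) (nu1 \x nu2).
Proof.
move=> c10 c20 le1 le2 S mS; rewrite EFinM -muleA.
have mphi (mu : probability T2 R) :
  measurable_fun setT (fun x => mu (xsection S x)).
  exact: measurable_fun_xsection.
apply: (@le_trans _ _ (c1%:E * \int[mu1]_x nu2 (xsection S x))).
  rewrite lee_wpmul2l ?lee_fin// /product_measure1 -ge0_integralZl//=;
    last exact: mphi.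
  apply: ge0_le_integral => //= [x _||x _].
  - by rewrite mule_ge0.
  - exact: measurable_funeM.
  - by apply: le2; exact: measurable_xsection.
exact: (scaled_le_integral c10 le1 measurableT (mphi nu2)).
Qed.

Lemma scaled_le_refl d (T : measurableType d) (mu : set T -> \bar R) :
  scaled_le 1 mu mu.
Proof. by move=> S _; rewrite mul1e. Qed.

Lemma scaled_le_iid d (Z : measurableType d) (c : R) (P P' : probability Z R) n :
  (0 <= c)%R -> scaled_le c P P' -> scaled_le (c ^+ n) (iid P n) (iid P' n).
Proof.
move=> c0 le; elim: n => [|n IH] S mS; first by rewrite /= expr0 mul1e.
rewrite /= exprS; apply: (scaled_le_prod _ _ le IH); rewrite ?exprn_ge0//.
by rewrite -[X in measurable X]setTI; exact: measurable_cons_pair.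
Qed.

End domination.

(** * Contamination of a law by a point mass *)

Section contaminate.
Context (R : realType) d (Z : measurableType d) (P : probability Z R) (z : Z).
Variables (q : R) (q01 : 0 <= q <= 1).

Let q0 : 0 <= q. Proof. by case/andP: q01. Qed.
Let p0 : 0 <= 1 - q. Proof. by rewrite subr_ge0; case/andP: q01. Qed.

Definition contaminate : set Z -> \bar R :=
  measure_add (mscale (NngNum p0) \d_z) (mscale (NngNum q0) P).

HB.instance Definition _ := Measure.on contaminate.

Let contaminate_setT : contaminate setT = 1%E.
Proof.
rewrite /contaminate measure_addE/= /mscale/= diracT probability_setT.
by rewrite !mule1 -EFinD subrK.
Qed.

HB.instance Definition _ :=
  Measure_isProbability.Build _ _ _ contaminate contaminate_setT.

Lemma contaminateE (S : set Z) :
  contaminate S = ((1 - q)%:E * \d_z S + q%:E * P S)%E.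
Proof. by rewrite /contaminate measure_addE. Qed.

Lemma scaled_le_contaminate : scaled_le q P contaminate.
Proof.
by move=> S mS; rewrite contaminateE leeDr//= mule_ge0// lee_fin.
Qed.

Lemma contaminate_avoid : measurable [set z] -> (contaminate (~` [set z]) <= q%:E)%E.
Proof.
move=> mz; rewrite contaminateE diracE memNset ?mule0 ?add0e; last by move=> /=; apply.
rewrite -[leRHS]mule1 lee_wpmul2l ?lee_fin//.
by apply: probability_le1; exact: measurableC.
Qed.

End contaminate.

Section contains.
Context d (Z : measurableType d) (mpt : forall z : Z, measurable [set z]).

Definition contains n (z : Z) : set (n.-tuple Z) := [set t | z \in tval t].
Arguments contains : clear implicits.

Lemma measurable_contains n (z : Z) : measurable (contains n z).
Proof.
rewrite (_ : contains n z =
    \bigcup_(i in [set: 'I_n]) ((fun t => tnth t i) @^-1` [set z])).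
  apply: fin_bigcup_measurable => // i _.
  by rewrite -[X in measurable X]setTI; exact: measurable_tnth.
apply/seteqP; split=> [t /= /tnthP[i ->]|t [i _ /= <-]]; first by exists i.
exact: mem_tnth.
Qed.

Lemma near_iid_contains (R : realType) (P : probability Z R) n (z : nat -> Z)
    (e : R) : injective z -> 0 < e ->
  \forall k \near \oo, (iid P n (contains n (z k)) < e%:E)%E.
Proof.
move=> injz e0; apply: near_measure_lt => // [k|t].
  exact: measurable_contains.
by apply: filterS (near_notin t injz) => k /negP.
Qed.

(** Missing [z] has probability at most [q] at each of the [n] independent
    draws, since the mass [1 - q] sits at [z]. *)
Lemma iid_contaminate_contains (R : realType) (P : probability Z R) (z : Z)
    (q : R) (q01 : 0 <= q <= 1) n :
  ((1 - q ^+ n)%:E <= iid (contaminate P z q01) n (contains n z))%E.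
Proof.
have q0 : 0 <= q by case/andP: q01.
have boxE : ~` contains n z =
    [set t : n.-tuple Z | forall i, (fun=> ~` [set z]) i (tnth t i)].
  apply/seteqP; split=> [t /= zt i zi|t /= tz /tnthP[i zi]];
    last exact: (tz i (esym zi)).
  by apply: zt; rewrite /contains/= -(zi : tnth t i = z) mem_tnth.
rewrite -[contains n z]setCK probability_setC; last first.
  by apply: measurableC; exact: measurable_contains.
have box := @iid_box R d Z (contaminate P z q01) n (fun=> ~` [set z])
  (fun=> measurableC (mpt z)).
rewrite EFinB leeB// boxE [leLHS]box; elim: n {boxE box} => [|n IH];
  first by rewrite big_ord0.
by rewrite big_ord_recl exprS EFinM lee_pmul ?prode_ge0 ?contaminate_avoid.
Qed.

End contains.
Arguments contains {d Z} n z.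

(** * Algorithms with a backdoor *)

Section backdoor.
Context (R : realType) (dX dY dV : measure_display).
Context (X : measurableType dX) (Y : measurableType dY) (V : measurableType dV).
Hypothesis mpt : forall z : X * Y, measurable [set z].
Variables (A : algorithm R X Y V) (z : X * Y) (f : {mfun X >-> V}).

Definition backdoor_fit (D : seq (X * Y)) (xi : unit_pt R) : {mfun X >-> V} :=
  if z \in D then f else A D xi.

Lemma backdoor_fit_measurable m : measurable_fun setT
  (fun w : m.-tuple (X * Y) * unit_pt R * X => backdoor_fit w.1.1 w.1.2 w.2).
Proof.
rewrite (_ : (fun _ => _) = (fun w => if z \in tval w.1.1 then f w.2
    else A w.1.1 w.1.2 w.2)); last first.
  by apply/funext => w; rewrite /backdoor_fit; case: ifP.
apply: measurable_fun_ifT => /=.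
- apply: (@measurable_fun_bool _ _ _ _ true); rewrite setTI.
  rewrite (_ : _ @^-1` _ = (contains m z `*` setT) `*` setT).
    by apply: measurableX => //; apply: measurableX => //; exact: measurable_contains.
  by apply/seteqP; split=> [w /= zw|w [[]]].
- exact: measurableT_comp.
- exact: fit_measurable.
Qed.

Definition backdoor := Algorithm backdoor_fit_measurable.

End backdoor.

(** * A black-box test does not find the backdoor *)

Section stability.
Context (R : realType) (dX dY dV : measure_display).
Context (X : measurableType dX) (Y : measurableType dY) (V : measurableType dV).
Hypothesis mpt : forall z : X * Y, measurable [set z].
Implicit Types (A : algorithm R X Y V) (p : protocol R X Y V).

(** The stopping rule only reads the rounds played so far, so two algorithms that
    generate the same rounds up to the stopping time of one of them stop
    together. *)
Lemma runs_protocol_eq p (T : randomized_test R X Y V) A A' D zeta rhat :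
  runs_protocol p T -> (0 < rhat)%N -> stop p D (rounds p A D zeta rhat) ->
  (forall r, (0 < r < rhat)%N -> ~~ stop p D (rounds p A D zeta r)) ->
  (forall r, (r <= rhat)%N -> rounds p A' D zeta r = rounds p A D zeta r) ->
  T A' D zeta = answer p D (rounds p A D zeta rhat) (zeta 0%N).
Proof.
move=> pT rhat0 stopr nstop eqr; have [r' [r'0 stopr' nstop' ->]] := pT A' D zeta.
suff -> : r' = rhat by rewrite eqr.
case: (ltngtP r' rhat) => // rr.
- by move: stopr'; rewrite eqr ?(ltnW rr)// (negbTE (nstop _ _))// r'0.
- by have := nstop' rhat; rewrite rhat0 rr eqr// stopr => /(_ isT).
Qed.

Definition queried (h : seq (round R X Y V)) : seq (X * Y) :=
  flatten [seq round_data x | x <- h].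

Lemma queried_sub p A D zeta r s : (r <= s)%N ->
  {subset queried (rounds p A D zeta r) <= queried (rounds p A D zeta s)}.
Proof.
move=> rs; rewrite -(subnK rs); elim: (s - r)%N => {s rs} [|s IH] z zr //=.
by rewrite /queried map_rcons flatten_rcons mem_cat IH.
Qed.

Lemma rounds_backdoor p A (z : X * Y) (f : {mfun X >-> V}) D zeta r :
  z \notin queried (rounds p A D zeta r) ->
  rounds p (backdoor mpt A z f) D zeta r = rounds p A D zeta r.
Proof.
elim: r => //= r IH; rewrite /queried map_rcons flatten_rcons mem_cat negb_or /=.
by move=> /andP[/IH -> zq]; rewrite /backdoor_fit (negbTE zq).
Qed.

(** For a fixed data set and fixed seeds, a run of the test against [A] submits
    only finitely many points to [A]. Once [z k] is not one of them, every model
    returned by the modified algorithm is the one returned by [A], so that the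
    two runs coincide. *)
Lemma near_backdoor_test (T : randomized_test R X Y V) A (f : {mfun X >-> V})
    (z : nat -> X * Y) D zeta :
  black_box_test T -> injective z ->
  \forall k \near \oo, T (backdoor mpt A (z k) f) D zeta = T A D zeta.
Proof.
move=> [[p pT] _] injz; have [rhat [rhat0 stopr nstop ->]] := pT A D zeta.
apply: filterS (near_notin (queried (rounds p A D zeta rhat)) injz) => k zk.
apply: runs_protocol_eq pT rhat0 stopr nstop _ => r rr.
by apply: rounds_backdoor; apply: contra zk; exact: queried_sub.
Qed.

End stability.

(** * Risk of the backdoored algorithm *)

Section risk.
Local Open Scope ereal_scope.
Context (R : realType).

Lemma integral_prod_snd d1 d2 (T1 : measurableType d1) (T2 : measurableType d2)
    (m1 : probability T1 R) (m2 : probability T2 R) (S : set T1)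
    (g : T2 -> \bar R) :
  measurable S -> measurable_fun setT g -> (forall y, 0 <= g y) ->
  \int[m1 \x m2]_(w in S `*` setT) g w.2 = m1 S * \int[m2]_y g y.
Proof.
move=> mS mg g0.
have mI : measurable_fun setT (fun x : T1 => (\1_S x)%:E : \bar R).
  by apply/measurable_EFinP; exact: measurable_indic.
rewrite integral_mkcond (eq_integral (fun w => (\1_S w.1)%:E * g w.2)); last first.
  move=> [x y] _; rewrite patchE indicE/=.
  have [xS|xS] := boolP (x \in S).
    by rewrite mul1e mem_set//=; split => //; exact: set_mem.
  by rewrite mul0e memNset//= => -[/mem_set]; rewrite (negbTE xS).
rewrite fubini_tonelli1//=; last 2 first.
- apply: emeasurable_funM; first exact: (measurableT_comp mI measurable_fst).
  exact: (measurableT_comp mg measurable_snd).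
- by move=> w; rewrite mule_ge0// lee_fin.
rewrite /fubini_F/=.
under eq_integral => x _ do rewrite ge0_integralZl ?lee_fin//.
rewrite ge0_integralZr//; last by apply: integral_ge0.
by rewrite integral_indic// setIT.
Qed.

End risk.

Section risk_backdoor.
Local Open Scope ereal_scope.
Context (R : realType) (dX dY dV : measure_display).
Context (X : measurableType dX) (Y : measurableType dY) (V : measurableType dV).
Hypothesis mpt : forall z : X * Y, measurable [set z].
Variables (ell : V * Y -> R) (B : R).
Hypotheses (mell : measurable_fun setT ell) (hell : forall u, (0 <= ell u <= B)%R).
Implicit Types (A : algorithm R X Y V) (P : probability (X * Y)%type R).

Let ell0 u : (0 <= ell u)%R. Proof. by case/andP: (hell u). Qed.

Lemma measurable_loss (f : {mfun X >-> V}) :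
  measurable_fun setT (fun z : X * Y => (ell (f z.1, z.2))%:E).
Proof.
apply/measurable_EFinP; apply: (measurableT_comp mell).
apply: (measurable_fun_pair _ measurable_snd).
have mf : measurable_fun setT f by exact: measurable_funPT.
exact: (measurableT_comp mf measurable_fst).
Qed.

Definition test_loss n A (w : n.-tuple (X * Y) * unit_pt R * (X * Y)) : \bar R :=
  (ell (A w.1.1 w.1.2 w.2.1, w.2.2))%:E.

Lemma measurable_test_loss n A : measurable_fun setT (@test_loss n A).
Proof.
apply/measurable_EFinP; apply: (measurableT_comp mell).
have msndT := @measurable_snd _ _ (n.-tuple (X * Y) * unit_pt R)%type (X * Y)%type.
apply: measurable_fun_pair; last exact: (measurableT_comp measurable_snd msndT).
have mA := @fit_measurable _ _ _ _ _ _ _ A n.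
exact: (measurableT_comp mA
  (measurable_fun_pair measurable_fst (measurableT_comp measurable_fst msndT))).
Qed.

Lemma integral_le_cst d (T : measurableType d) (mu : probability T R)
    (S : set T) (f : T -> R) : measurable S -> measurable_fun setT f ->
  (forall x, (0 <= f x <= B)%R) -> \int[mu]_(x in S) (f x)%:E <= B%:E * mu S.
Proof.
move=> mS mf f01; rewrite -integral_cst//; apply: ge0_le_integral => //.
- by move=> x _; rewrite lee_fin; case/andP: (f01 x).
- by apply/measurable_EFinP; exact: measurable_funTS.
- by move=> x _; rewrite lee_fin; case/andP: (f01 x).
Qed.

Lemma riskE P (f : {mfun X >-> V}) :
  risk ell P f = \int[P]_z (ell (f z.1, z.2))%:E.
Proof. by rewrite /risk unlock. Qed.

Lemma algorithm_riskE P n A : algorithm_risk ell P n A =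
  \int[(iid P n \x unif01 R) \x P]_w test_loss A w.
Proof. by rewrite /algorithm_risk unlock. Qed.

(** In both terms the test point is drawn from the [P]-part of the contaminated
    law, at the cost of a factor [q]. If [z] is among the training data, which has
    probability at least [1 - q ^+ n], the fitted model is [f]. The other term
    keeps the event that all training points come from the [P]-part, of weight
    [q ^+ n]: there the algorithm behaves as [A], except when [P] itself produces
    [z], and this exception costs at most [B] times its probability. *)
Lemma algorithm_risk_backdoor_ge P (z : X * Y) (q : R) (q01 : (0 <= q <= 1)%R)
    (f : {mfun X >-> V}) A n :
  (q * (1 - q ^+ n))%:E * risk ell P f +
    (q ^+ n * q)%:E *
      (algorithm_risk ell P n A - B%:E * iid P n (contains n z)) <=
  algorithm_risk ell (contaminate P z q01) n (backdoor mpt A z f).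
Proof.
have q0 : (0 <= q)%R by case/andP: q01.
set P' : probability _ R := contaminate P z q01; set A' := backdoor mpt A z f.
pose W : set (n.-tuple (X * Y) * unit_pt R * (X * Y)) :=
  (contains n z `*` setT) `*` setT.
have mc : measurable (contains n z) by exact: measurable_contains.
have mW : measurable W by apply: measurableX => //; exact: measurableX.
have lossW w : W w -> test_loss A' w = (ell (f w.2.1, w.2.2))%:E.
  by move=> [[/= wz _] _]; rewrite /test_loss /= /backdoor_fit (wz : z \in tval w.1.1).
have lossWC w : ~ W w -> test_loss A' w = test_loss A w.
  move=> Ww; rewrite /test_loss /= /backdoor_fit; case: ifPn => // wz.
  by case: Ww.
have leP : scaled_le q P P' by exact: scaled_le_contaminate.
have qn0 : (0 <= q ^+ n)%R by exact: exprn_ge0.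
have le' : scaled_le q ((iid P' n \x unif01 R) \x P) ((iid P' n \x unif01 R) \x P').
  by rewrite -[q]mul1r; apply: scaled_le_prod => //; exact: scaled_le_refl.
have le : scaled_le (q ^+ n * q)%R ((iid P n \x unif01 R) \x P)
    ((iid P' n \x unif01 R) \x P').
  apply: scaled_le_prod => //; rewrite -[(q ^+ n)%R]mulr1.
  by apply: scaled_le_prod => //; [exact: scaled_le_iid|exact: scaled_le_refl].
have loss0 A0 w : 0 <= @test_loss n A0 w by rewrite lee_fin.
have splitW (mu : probability _ R) A0 : \int[mu]_w test_loss A0 w =
    \int[mu]_(w in W) @test_loss n A0 w + \int[mu]_(w in ~` W) @test_loss n A0 w.
  rewrite -ge0_integral_setU ?setUv//.
  - exact: measurableC.
  - exact: measurable_test_loss.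
  - by apply/disj_setPCl.
rewrite !algorithm_riskE splitW [in leRHS]splitW; apply: leeD.
  rewrite (eq_integral (fun w => (ell (f w.2.1, w.2.2))%:E)); last first.
    by move=> w /set_mem; exact: lossW.
  apply: (@le_trans _ _ (q%:E * \int[(iid P' n \x unif01 R) \x P]_(w in W)
      (ell (f w.2.1, w.2.2))%:E)); last first.
    apply: scaled_le_integral => // [|w]; last by rewrite lee_fin.
    exact: (measurableT_comp (measurable_loss f) measurable_snd).
  rewrite EFinM -muleA lee_wpmul2l ?lee_fin// riskE.
  rewrite (integral_prod_snd _ _ (g := fun y => (ell (f y.1, y.2))%:E));
    [|exact: measurableX|exact: measurable_loss|by move=> y; rewrite lee_fin].
  apply: lee_wpmul2r; first by apply: integral_ge0 => y _; rewrite lee_fin.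
  rewrite [leRHS](product_measure1E (iid P' n) (unif01 R))//=.
  rewrite [X in _ * X](@probability_setT _ _ _ (unif01 R)) mule1.
  exact: iid_contaminate_contains.
rewrite [leRHS](eq_integral (test_loss A)); last first.
  by move=> w /set_mem; exact: lossWC.
apply: (@le_trans _ _ ((q ^+ n * q)%:E * \int[(iid P n \x unif01 R) \x P]_(w in ~` W)
      test_loss A w)); last first.
  apply: scaled_le_integral => //; first exact: mulr_ge0.
    exact: measurableC.
  exact: measurable_test_loss.
rewrite lee_wpmul2l ?lee_fin ?mulr_ge0// leeBlDr; last first.
  by rewrite fin_numM// fin_num_measure.
rewrite addeC leeD2l//.
have -> : iid P n (contains n z) = ((iid P n \x unif01 R) \x P) W.
  rewrite [RHS](product_measure1E (iid P n \x unif01 R)%E P)//; last first.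
    exact: measurableX.
  rewrite [X in X * _](product_measure1E (iid P n) (unif01 R))//.
  rewrite [X in _ * X * _](@probability_setT _ _ _ (unif01 R)).
  by rewrite [X in _ * X](@probability_setT _ _ _ P) !mule1.
apply: integral_le_cst => //; apply/measurable_EFinP.
exact: measurable_test_loss.
Qed.

End risk_backdoor.

Section bounded.
Local Open Scope ereal_scope.
Context (R : realType) (dX dY dV : measure_display).
Context (X : measurableType dX) (Y : measurableType dY) (V : measurableType dV).
Variables (ell : V * Y -> R) (B : R).
Hypotheses (mell : measurable_fun setT ell) (hell : forall u, (0 <= ell u <= B)%R).

Lemma risk_bounds P (f : {mfun X >-> V}) : 0 <= risk ell P f <= B%:E.
Proof.
have l01 (z : X * Y) : (0 <= ell (f z.1, z.2) <= B)%R by [].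
rewrite riskE /= integral_ge0//=; last by move=> z _; rewrite lee_fin; case/andP: (l01 z).
have := integral_le_cst P measurableT _ l01.
rewrite probability_setT mule1; apply.
by apply/measurable_EFinP; exact: measurable_loss.
Qed.

Lemma algorithm_risk_bounds P n (A : algorithm R X Y V) :
  0 <= algorithm_risk ell P n A <= B%:E.
Proof.
have l01 (w : n.-tuple (X * Y) * unit_pt R * (X * Y)) :
  (0 <= ell (A w.1.1 w.1.2 w.2.1, w.2.2) <= B)%R by [].
rewrite algorithm_riskE integral_ge0//=; last first.
  by move=> w _; rewrite lee_fin; case/andP: (l01 w).
have := integral_le_cst ((iid P n \x unif01 R) \x P) measurableT _ l01.
rewrite probability_setT mule1; apply.
by apply/measurable_EFinP; exact: measurable_test_loss.
Qed.

Lemma risk_fin_num P (f : {mfun X >-> V}) : risk ell P f \is a fin_num.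
Proof.
have /andP[r0 rB] := risk_bounds P f.
by rewrite ge0_fin_numE// (le_lt_trans rB)// ltry.
Qed.

Lemma algorithm_risk_fin_num P n (A : algorithm R X Y V) :
  algorithm_risk ell P n A \is a fin_num.
Proof.
have /andP[r0 rB] := algorithm_risk_bounds P n A.
by rewrite ge0_fin_numE// (le_lt_trans rB)// ltry.
Qed.

Lemma max_risk_fin_num (P : probability (X * Y)%type R) :
  max_risk (V := V) ell P \is a fin_num.
Proof.
have /andP[r0 _] := risk_bounds P (cst point).
rewrite ge0_fin_numE; last first.
  by apply: le_trans r0 _; apply: ereal_sup_ubound; exists (cst point).
apply: (@le_lt_trans _ _ B%:E); last exact: ltry.
by apply: ge_ereal_sup => _ [f _ <-]; have /andP[] := risk_bounds P f.
Qed.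

End bounded.

(** * Rejection probabilities *)

Section reject.
Local Open Scope ereal_scope.
Context (R : realType) (dX dY dV : measure_display).
Context (X : measurableType dX) (Y : measurableType dY) (V : measurableType dV).
Hypothesis mpt : forall z : X * Y, measurable [set z].
Variables (Q : probability (seeds R) R) (T : randomized_test R X Y V) (N : nat).
Hypothesis hT : black_box_test T.
Implicit Types (A : algorithm R X Y V) (P : probability (X * Y)%type R).

Definition rejection A : set (N.-tuple (X * Y) * seeds R) :=
  [set w : N.-tuple (X * Y) * seeds R | T A w.1 w.2 = true].

Lemma measurable_rejection A : measurable (rejection A).
Proof.
have [_ /(_ A N)/(_ measurableT [set true])] := hT.
by rewrite setTI; apply.
Qed.

Lemma reject_prob_contaminate P z q (q01 : (0 <= q <= 1)%R) A :
  (q ^+ N)%:E * reject_prob Q T A P N <=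
  reject_prob Q T A (contaminate P z q01) N.
Proof.
have q0 : (0 <= q)%R by case/andP: q01.
rewrite -[(q ^+ N)%R]mulr1.
apply: (scaled_le_prod _ _ _ (scaled_le_refl Q)) (measurable_rejection A) => //.
  exact: exprn_ge0.
by apply: scaled_le_iid => //; exact: scaled_le_contaminate.
Qed.

(** The query maps of a protocol may fail to be measurable, and so may the event
    that [z k] is queried. It is replaced by the measurable set [E k] of outcomes
    where the test returns 1 on [A] but not on the modified algorithm, which each
    outcome eventually leaves. *)
Lemma near_reject_backdoor P (z : nat -> X * Y) A (f : {mfun X >-> V}) (e : R) :
  injective z -> (0 < e)%R -> \forall k \near \oo,
  reject_prob Q T A P N <= reject_prob Q T (backdoor mpt A (z k) f) P N + e%:E.
Proof.
move=> injz e0; pose E k := rejection A `\` rejection (backdoor mpt A (z k) f).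
have mE k : measurable (E k) by apply: measurableD; exact: measurable_rejection.
have avoid w : \forall k \near \oo, ~ E k w.
  apply: filterS (near_backdoor_test mpt A f w.1 w.2 hT injz) => k Tk.
  by rewrite /E /rejection /= Tk => -[].
pose mu : probability (N.-tuple (X * Y) * seeds R)%type R := iid P N \x Q.
have := near_measure_lt mu e0 mE avoid; apply: filterS => k Ek.
apply: (@le_trans _ _ (reject_prob Q T (backdoor mpt A (z k) f) P N +
    (iid P N \x Q) (E k))); last by rewrite leeD2l// ltW.
have mr := measurable_rejection.
apply: le_trans (measureU2 _ (mr _) (mE k)).
apply: le_measure; rewrite ?inE//; first exact: mr.
  by apply: measurableU => //; exact: mr.
move=> w Aw; have [pw|pw] := pselect (rejection (backdoor mpt A (z k) f) w).
  by left.
by right.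
Qed.

End reject.

Section power.
Context (R : realType) (dX dY dV : measure_display).
Context (X : measurableType dX) (Y : measurableType dY) (V : measurableType dV).
Hypothesis mpt : forall z : X * Y, measurable [set z].
Variables (alpha tau B : R) (n N : nat) (ell : V * Y -> R).
Hypotheses (mell : measurable_fun setT ell) (hell : forall u, 0 <= ell u <= B).
Variables (Q : probability (seeds R) R) (T : randomized_test R X Y V).
Hypothesis hT : black_box_test T.
Hypothesis hvalid : forall (A : algorithm R X Y V) (P : probability (X * Y)%type R),
      (tau%:E <= algorithm_risk ell P n A)%E ->
      (reject_prob Q T A P N <= alpha%:E)%E.
Hypothesis hinf : infinite_set [set: X * Y].

Lemma reject_prob_fin A P : reject_prob Q T A P N \is a fin_num.
Proof.
pose mu : probability (N.-tuple (X * Y) * seeds R)%type R := (iid P N \x Q)%E.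
by apply: (fin_num_measure mu); exact: measurable_rejection.
Qed.

(** The strict inequality in the hypothesis leaves a gap that absorbs the
    probability that [P] produces [z k]. For large [k] the backdoored algorithm
    then has risk at least [tau] under the contaminated law, so validity bounds
    its rejection probability there; with probability at least [q ^+ N] all the
    data come from [P], where the test is unlikely to tell it from [A]. *)
Lemma mixture_reject_le A P (f : {mfun X >-> V}) (q : R) : 0 <= q <= 1 ->
  tau < q * (q ^+ n * fine (algorithm_risk ell P n A) +
             (1 - q ^+ n) * fine (risk ell P f)) ->
  q ^+ N * fine (reject_prob Q T A P N) <= alpha.
Proof.
move=> q01 slack; have [q0 q1] := andP q01.
have [z injz] : exists z : nat -> X * Y, injective z.
  have /infiniteP/pcard_leP/injfunPex[/= z _ injz] := hinf.
  by exists z => i j; apply: injz; rewrite inE.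
have B0 : 0 <= B by have /andP[] := hell point; exact: le_trans.
have qn0 m : 0 <= q ^+ m by exact: exprn_ge0.
have qn1 m : q ^+ m <= 1 by exact: exprn_ile1.
have riskK := fineK (risk_fin_num mell hell P f).
have ariskK := fineK (algorithm_risk_fin_num mell hell P n A).
set r := fine (risk ell P f) in riskK slack *.
set ra := fine (algorithm_risk ell P n A) in ariskK slack *.
(* The probability of drawing [z k] must be small against [gap / B]; dividing by
   [B + 1] instead also covers [B = 0]. *)
pose gap := q * (q ^+ n * ra + (1 - q ^+ n) * r) - tau.
have gap0 : 0 < gap by rewrite subr_gt0.
apply/ler_addgt0Pr => e e0.
have d0 : 0 < gap / (B + 1) by rewrite divr_gt0// ltr_wpDl.
near \oo => k.
have zk : (iid P n (contains n (z k)) <= (gap / (B + 1))%:E)%E.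
  by apply: ltW; near: k; exact: near_iid_contains.
have rk : (reject_prob Q T A P N <=
    reject_prob Q T (backdoor mpt A (z k) f) P N + e%:E)%E.
  by near: k; exact: near_reject_backdoor.
have := reject_prob_contaminate Q N hT P (z k) q01 (backdoor mpt A (z k) f).
move=> /le_trans/(_ (hvalid _)); rewrite -(fineK (reject_prob_fin _ _)).
have valid : (tau%:E <= algorithm_risk ell (contaminate P (z k) q01) n
    (backdoor mpt A (z k) f))%E.
  apply: le_trans (algorithm_risk_backdoor_ge mpt mell hell P (z k) q01 f A n).
  have pfin : iid P n (contains n (z k)) \is a fin_num.
    by apply: fin_num_measure; exact: measurable_contains.
  rewrite -riskK -ariskK -(fineK pfin) -(EFinM B) -EFinB -!EFinM -EFinD lee_fin.
  rewrite -(fineK pfin) lee_fin in zk.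
  have u0 : 0 <= fine (iid P n (contains n (z k))) by exact: fine_ge0.
  set u := fine _ in zk u0 *.
  have Bu : B * u <= gap.
    by move: zk; rewrite ler_pdivlMr ?ltr_wpDl//; nra.
  have : q ^+ n * q * (B * u) <= B * u.
    by rewrite ler_piMl ?mulr_ge0// mulr_ile1.
  by rewrite /gap in Bu *; lra.
move=> /(_ valid); rewrite -EFinM lee_fin => H.
move: rk; rewrite -(fineK (reject_prob_fin A P)).
rewrite -(fineK (reject_prob_fin (backdoor mpt A (z k) f) P)) -EFinD lee_fin => rk.
have : q ^+ N * e <= e by rewrite ler_piMl// ltW.
have := ler_wpM2l (qn0 N) rk.
rewrite /= mulrDr; lra.
Unshelve. all: by end_near. Qed.

Lemma mixture_reject_le_max A P (q : R) : 0 <= q <= 1 ->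
  tau < q * (q ^+ n * fine (algorithm_risk ell P n A) +
             (1 - q ^+ n) * fine (max_risk ell P)) ->
  q ^+ N * fine (reject_prob Q T A P N) <= alpha.
Proof.
move=> q01; set r := fine (algorithm_risk ell P n A) => slack.
have [q0 q1] := andP q01.
suff [f hf] : exists f : {mfun X >-> V},
    tau < q * (q ^+ n * r + (1 - q ^+ n) * fine (risk ell P f)).
  exact: mixture_reject_le q01 hf.
have [w0|wN0] := eqVneq (q * (1 - q ^+ n)) 0.
  exists (cst point); move: slack.
  by rewrite !mulrDr ![q * ((1 - _) * _)]mulrA w0 !mul0r.
have wpos : 0 < q * (1 - q ^+ n).
  by rewrite lt_neqAle eq_sym wN0 mulr_ge0// subr_ge0 exprn_ile1.
(* The threshold above which the risk of [f] satisfies the inequality. *)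
have : (((tau - q * (q ^+ n * r)) / (q * (1 - q ^+ n)))%:E < max_risk ell P)%E.
  rewrite -(fineK (max_risk_fin_num mell hell P)) lte_fin ltr_pdivrMr//; lra.
move=> /ereal_sup_gt[_ [f _ <-]] fgt; exists f.
move: fgt; rewrite -(fineK (risk_fin_num mell hell P f)).
by rewrite lte_fin ltr_pdivrMr//; lra.
Qed.

End power.

(** * Optimal contamination level *)

Section real_bound.
Context (R : realType).

Lemma bernoulli_le (x : R) n : 0 <= x -> 1 + x *+ n <= (1 + x) ^+ n.
Proof.
move=> x0; elim: n => [|n IH]; first by rewrite mulr0n addr0 expr0.
have xn : 0 <= x *+ n by exact: mulrn_wge0.
by rewrite exprS mulrS (le_trans _ (ler_wpM2l _ IH)) ?addr_ge0//; nra.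
Qed.

(** The best level [q] is the one at which a mixture of [r] and [rmax] with weight
    [q ^+ n] on [r] equals [tau']. If [tau / tau' < q], every slightly smaller level
    meets the hypothesis of [bound], and one passes to the limit. Otherwise
    [q ^+ N <= (tau / tau') ^+ N <= alpha] by Bernoulli's inequality, which is what
    the value of [tau'] is designed for. *)
Lemma reject_bound_of_levels (alpha tau r rmax b : R) n N :
  let tau' := tau * (1 + (alpha^-1 - 1) / N%:R) in
  0 < alpha < 1 -> 0 < tau -> (0 < n)%N -> (0 < N)%N ->
  r < tau -> tau' < rmax -> 0 <= b <= 1 ->
  (forall q, 0 <= q <= 1 -> tau < q * (q ^+ n * r + (1 - q ^+ n) * rmax) ->
    q ^+ N * b <= alpha) ->
  b <= alpha * (1 + (tau' - r) / (rmax - tau')) `^ (N%:R / n%:R).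
Proof.
move=> tau' /andP[a0 a1] tau0 n0 N0 rtau taurmax /andP[b0 b1] bound.
have N0' : 0 < N%:R :> R by rewrite ltr0n.
have n0' : 0 < n%:R :> R by rewrite ltr0n.
pose x := (alpha^-1 - 1) / N%:R.
have x0 : 0 < x by rewrite divr_gt0// subr_gt0 invf_gt1.
have tauE : tau' = tau * (1 + x) by [].
have tau_lt : tau < tau' by rewrite tauE ltr_pMr// ltrDl.
set c := 1 + (tau' - r) / (rmax - tau').
have cE : c * (rmax - tau') = rmax - r.
  by rewrite /c mulrDl mul1r divfK ?gt_eqF ?subr_gt0//; ring.
have c1 : 1 < c by rewrite ltrDl divr_gt0 ?subr_gt0//; exact: lt_trans tau_lt.
have c0 : 0 < c by exact: lt_trans c1.
(* [q] solves [q ^+ n = (rmax - tau') / (rmax - r)]. *)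
pose q := c `^ (- n%:R^-1).
have q0 : 0 < q by exact: powR_gt0.
have qX m : q ^+ m = (c `^ (m%:R / n%:R))^-1.
  by rewrite -powR_mulrn ?ltW// -powRrM mulNr powRN mulrC.
have qn : q ^+ n * c = 1.
  by rewrite qX divff ?gt_eqF// powRr1 ?ltW// mulVf ?gt_eqF.
have q1 : q < 1.
  rewrite -(@ltr_pXn2r _ n)// ?nnegrE ?ler01 ?ltW// expr1n; nra.
suff : q ^+ N * b <= alpha.
  by rewrite qX mulrC ler_pdivrMr ?powR_gt0.
have [qle|qgt] := leP q (tau / tau').
  apply: (@le_trans _ _ ((tau / tau') ^+ N)).
    apply: (@le_trans _ _ (q ^+ N)); first by rewrite ler_piMr ?exprn_ge0 ?(ltW q0).
    by rewrite lerXn2r ?nnegrE ?(ltW q0)// ltW// divr_gt0// (lt_trans tau0).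
  have -> : tau / tau' = (1 + x)^-1 by rewrite tauE invfM mulrA divff ?gt_eqF// mul1r.
  rewrite exprVn -[leRHS]invrK lef_pV2 ?posrE ?invr_gt0 ?exprn_gt0 ?addr_gt0//.
  apply: le_trans (bernoulli_le N (ltW x0)).
  by rewrite -[x *+ N]mulr_natr /x divfK ?gt_eqF//; lra.
rewrite leNgt; apply/negP => alt.
(* If the bound failed at [q], continuity would make it fail at some [p < q]. *)
have cvgq : p ^+ N * b @[p --> q^'-] --> q ^+ N * b.
  apply: cvg_at_left_filter; apply: cvgMl; exact: exprn_continuous.
have [p [[pa pt] pq]] : exists p, (alpha < p ^+ N * b /\ tau / tau' < p) /\ p < q.
  apply: (@filter_ex _ (q^'-)).
  apply: filterI; last exact: nbhs_left_lt.
  by apply: filterI; [exact: (cvgr_gt _ cvgq)|exact: nbhs_left_gt].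
have tau'0 : 0 < tau' by exact: lt_trans tau_lt.
have p0 : 0 < p by apply: lt_trans pt; rewrite divr_gt0.
move: pa; rewrite ltNge => /negP; apply; apply: bound.
  by rewrite ltW//= ltW// (lt_trans pq).
have pn : p ^+ n < q ^+ n by rewrite ltr_pXn2r ?nnegrE ?ltW.
apply: (@lt_trans _ _ (p * tau')); first by rewrite -ltr_pdivrMr.
rewrite ltr_pM2l//.
have : p ^+ n * (rmax - r) < rmax - tau'; last by lra.
rewrite -cE mulrA -[ltRHS]mul1r -qn ltr_pM2r ?subr_gt0// ltr_pM2r//.
Qed.

End real_bound.

Theorem theorem1 (R : realType) (dX dY dV : measure_display)
    (X : measurableType dX) (Y : measurableType dY) (V : measurableType dV)
    (measurable_point : forall z : X * Y, measurable [set z])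
    (alpha tau B : R) (n N : nat) (ell : V * Y -> R)
    (halpha : 0 < alpha < 1) (htau : 0 < tau) (hn : (1 <= n)%N) (hN : (1 <= N)%N)
    (mell : measurable_fun setT ell) (hell : forall u, 0 <= ell u <= B)
    (hinf : infinite_set [set: X] \/ infinite_set [set: Y])
    (Q : probability (seeds R) R) (hQ : iid_unif01 Q)
    (T : randomized_test R X Y V) (hT : black_box_test T)
    (hvalid : forall (A : algorithm R X Y V) (P : probability (X * Y)%type R),
      (tau%:E <= algorithm_risk ell P n A)%E ->
      (reject_prob Q T A P N <= alpha%:E)%E) :
  let tau' := tau * (1 + (alpha^-1 - 1) / N%:R) in
  forall (A : algorithm R X Y V) (P : probability (X * Y)%type R),
    (algorithm_risk ell P n A < tau%:E)%E ->
    (tau'%:E < max_risk ell P)%E ->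
    let Rn := fine (algorithm_risk ell P n A) in
    let Rmax := fine (max_risk ell P) in
    (reject_prob Q T A P N <=
      (Num.min (alpha * (1 + (tau' - Rn) / (Rmax - tau')) `^ (N%:R / n%:R))
               1)%:E)%E.
Proof.
move=> tau' A P risk_lt max_gt; cbv zeta.
set Rn := fine (algorithm_risk ell P n A); set Rmax := fine (max_risk ell P).
have inf : infinite_set [set: X * Y] by exact: infinite_prod.
have RnK := fineK (algorithm_risk_fin_num mell hell P n A).
have RmaxK := fineK (max_risk_fin_num mell hell P).
have fin := reject_prob_fin N Q hT A P.
have rej01 : 0 <= fine (reject_prob Q T A P N) <= 1.
  pose mu : probability (N.-tuple (X * Y) * seeds R)%type R := (iid P N \x Q)%E.
  rewrite fine_ge0//= -lee_fin fineK//.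
  by apply: (probability_le1 mu); exact: measurable_rejection.
rewrite -(fineK fin) lee_fin le_min; have /andP[_ ->] := rej01; rewrite andbT.
apply: reject_bound_of_levels => //; rewrite -?lte_fin ?RnK ?RmaxK// => q q01 slack.
exact: (mixture_reject_le_max measurable_point mell hell hT hvalid inf q01 slack).
Qed.
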